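(* Let $\mathfrak n=\mathfrak v\oplus\mathfrak z$ be a Lie algebra of Heisenberg type with $\mathfrak z=\mathbb R^m$. If $m\not\equiv0\pmod 4$, then ${\rm Aut}_o(\mathfrak n)$ acts transitively on ${\rm Lag}(\mathfrak n)$. If $m\equiv0\pmod4$ and $\mathfrak n=(\mathfrak v_m)^p\oplus\mathfrak z$, then ${\rm Lag}(\mathfrak n)$ is the union of $p+1$ orbits of ${\rm Aut}_o(\mathfrak n)$.
   Context: Lie algebra of Heisenberg type: $\mathfrak z=\mathbb R^m$ with standard inner product; $\mathfrak v$ a finite-dimensional real module over the Clifford algebra $C(m)$ (relations $z^2=-\langle z,z\rangle1$) with an inner product making each $J_z$ skew-symmetric; $\mathfrak z$ central and $\langle z,[u,v]\rangle=(J_zu,v)$. For $m\not\equiv3\pmod4$ there is a unique irreducible $C(m)$-module $\mathfrak v_m$ up to isomorphism, and $(\mathfrak v_m)^p$ denotes the direct sum of $p$ copies. ${\rm Lag}(\mathfrak n)$ is the set of subspaces $\mathcal L\subset\mathfrak v$ with $[\mathcal L,\mathcal L]=0$ and $\dim\mathcal L=\frac12\dim\mathfrak v$. ${\rm Aut}_o(\mathfrak n)$ is the group of Lie algebra automorphisms of $\mathfrak n$ acting trivially on $\mathfrak z$, viewed as the group of linear automorphisms $\xi$ of $\mathfrak v$ with $[\xi u,\xi v]=[u,v]$ for all $u,v\in\mathfrak v$; it acts on ${\rm Lag}(\mathfrak n)$. *)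

(* Defs.v *)
From HB Require Import structures.
From mathcomp Require Import all_boot all_order all_algebra.
From mathcomp Require Import reals.
Set Implicit Arguments. Unset Strict Implicit. Unset Printing Implicit Defensive.
Import Order.TTheory GRing.Theory Num.Theory.
Local Open Scope ring_scope.

(* Lie algebras of Heisenberg type n = v (+) z, z = R^m, v = R^n (row vectors).
   The Clifford action of z on v is given by J_z = \sum_i z_i J_i, acting on
   row vectors by right multiplication u |-> u *m J_z.
   The inner product on v is (u,w) = u G w^T with G symmetric positive definite. *)

Section HType.
Variables (R : realType) (m n : nat).

Definition zip (z z' : 'rV[R]_m) : R := (z *m z'^T) 0 0.

Definition Jz (J : 'I_m -> 'M[R]_n) (z : 'rV[R]_m) : 'M[R]_n :=
  \sum_(i < m) z 0 i *: J i.

Definition vip (G : 'M[R]_n) (u w : 'rV[R]_n) : R := (u *m G *m w^T) 0 0.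

(* Heisenberg-type data: C(m)-module structure (z^2 = -<z,z> 1), inner product,
   skew-symmetry of every J_z.  (m >= 1: the center is nontrivial.) *)
Definition is_HType (J : 'I_m -> 'M[R]_n) (G : 'M[R]_n) : Prop :=
  [/\ (0 < m)%N,
      G^T = G,
      (forall u : 'rV[R]_n, u != 0 -> 0 < vip G u u),
      (forall z : 'rV[R]_m, Jz J z *m Jz J z = - (zip z z) *: 1%:M)
    & (forall (z : 'rV[R]_m) (u w : 'rV[R]_n),
         vip G (u *m Jz J z) w = - vip G u (w *m Jz J z))].

(* the bracket [u,w] in z, characterized by <z,[u,w]> = (J_z u, w);
   its i-th coordinate is (J_{e_i} u, w) *)
Definition bracket (J : 'I_m -> 'M[R]_n) (G : 'M[R]_n) (u w : 'rV[R]_n)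
  : 'rV[R]_m := \row_i vip G (u *m J i) w.

Definition isLag J G (L : 'M[R]_n) : Prop :=
  (forall u w : 'rV[R]_n, (u <= L)%MS -> (w <= L)%MS -> bracket J G u w = 0)
  /\ (2 * \rank L = n)%N.

Definition isAuto_o J G (xi : 'M[R]_n) : Prop :=
  xi \in unitmx /\
  forall u w : 'rV[R]_n, bracket J G (u *m xi) (w *m xi) = bracket J G u w.

Definition same_orbit J G (L1 L2 : 'M[R]_n) : Prop :=
  exists xi, isAuto_o J G xi /\ (L1 *m xi == L2)%MS.

Definition Cinvariant J (V : 'M[R]_n) : Prop :=
  forall z : 'rV[R]_m, (V *m Jz J z <= V)%MS.

Definition Cirreducible J (V : 'M[R]_n) : Prop :=
  [/\ Cinvariant J V, \rank V != 0%N &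
      forall W : 'M[R]_n, (W <= V)%MS -> Cinvariant J W ->
        \rank W = 0%N \/ (W == V)%MS].

(* v is (isomorphic to) (v_m)^p: a direct sum of p irreducible C(m)-submodules
   (for m = 0 mod 4 all irreducible C(m)-modules are isomorphic to v_m) *)
Definition isotypic J (p : nat) : Prop :=
  exists V : 'I_p -> 'M[R]_n,
    [/\ forall k, Cirreducible J (V k),
        mxdirect (\sum_k V k)
      & (\sum_k V k == 1%:M)%MS].

End HType.

(* Main.v *)
(* A Lagrangian subspace L, viewed through the orthogonal reflection eps in L,
   is the same thing as a self-adjoint involution anticommuting with every J_i,
   that is, an extension of the J_i to a Clifford system of signature (m, 1).
   Two such extensions related by an invertible T commuting with the J_i give
   Lagrangians in one orbit: if N is the projector onto L, the map equal to T
   on L and to the inverse adjoint of T on its orthogonal complement is an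
   automorphism, so no polar decomposition is needed.

   For m odd, and for m = 2 mod 4, where the volume element of the extended
   system is a complex structure, the extended Clifford algebra is simple and
   has a single irreducible module, so T exists.  For m = 0 mod 4 the volume
   element w is a central involution; its eigenspaces are the isotypic parts
   of the two irreducible modules, so T exists exactly when the ranks of
   (1 + w) / 2 agree.  These ranks are the multiples k dim v_m with
   0 <= k <= p.  They are orbit invariants because automorphisms commute with
   even products of the J_i, hence with the volume element of the J_i.

   Nonzero intertwiners are found without averaging over the Clifford group:
   X |-> c_j a_j X b_j are commuting involutions, and a common eigenvector has
   its signs corrected by a left multiplication by a word in the a_j. *)

Require Import Defs.
From HB Require Import structures.
From mathcomp Require Import all_boot all_order all_algebra.
From mathcomp Require Import reals.
Import Order.TTheory GRing.Theory Num.Theory.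
Local Open Scope ring_scope.

Set Implicit Arguments.
Unset Strict Implicit.

(** * Words in Clifford generators and intertwiners between two Clifford systems *)

Section Words.
Context {R : realType} {r n : nat}.
Implicit Types (a b : 'I_r -> 'M[R]_n) (c : 'I_r -> R) (s : seq 'I_r).

Definition word a s : 'M[R]_n := foldr (fun i x => a i *m x) 1%:M s.

(** The signs [c i] are left free so that one notion covers both the [J i] and their extension by a
    reflection; [c i *: a i] is then the inverse of [a i]. *)
Definition clifford a c : Prop :=
  [/\ forall i, c i * c i = 1,
      forall i, a i *m a i = (c i)%:M
    & forall i j, i != j -> a i *m a j = - (a j *m a i)].

Lemma word_unit a c s : clifford a c -> word a s \in unitmx.
Proof.
case=> cc aa _; elim: s => [|i s IH] /=; first exact: unitmx1.
rewrite unitmx_mul IH andbT.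
have: a i *m (c i *: a i) = 1%:M by rewrite -scalemxAr aa scale_scalar_mx cc.
by case/mulmx1_unit.
Qed.

Lemma clifford_word_comm a c s i : clifford a c ->
  a i *m word a s =
    (-1) ^+ count (fun j => j != i) s *: (word a s *m a i).
Proof.
case=> _ _ ac; elim: s => [|j s IH] /=; first by rewrite mulmx1 mul1mx scale1r.
rewrite -!mulmxA; case: (eqVneq j i) => [->|ji] /=.
  by rewrite add0n IH -scalemxAr.
rewrite mulmxA ac 1?eq_sym // mulNmx -mulmxA IH -scalemxAr exprS.
by rewrite mulN1r scaleNr.
Qed.

Lemma count_neq_uniq s i : uniq s ->
  count (fun j => j != i) s = (size s - (i \in s))%N.
Proof.
by move=> us; rewrite -(count_predC (pred1 i) s) -count_uniq_mem // addKn.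
Qed.

Lemma word_commute a P s : (forall i, P *m a i = a i *m P) ->
  P *m word a s = word a s *m P.
Proof.
move=> Pa; elim: s => [|i s IH] /=; first by rewrite mulmx1 mul1mx.
by rewrite mulmxA Pa -!mulmxA IH.
Qed.

(** Moving the leading generator past the letters behind it costs one sign per letter; these costs
    add up to the binomial coefficient. *)
Lemma word_sq a c s : clifford a c -> uniq s ->
  word a s *m word a s =
    ((-1) ^+ 'C(size s, 2) * \prod_(i <- s) c i)%:M.
Proof.
move=> ca; have [_ aa _] := ca; elim: s => [|i s IH] /=.
  by rewrite big_nil mulmx1 mulr1.
case/andP=> si us; have := clifford_word_comm s i ca.
rewrite count_neq_uniq // (negPf si) subn0 => C.
rewrite {1}C -scalemxAl -mulmxA (mulmxA (a i)) aa mul_scalar_mx -scalemxAr IH //.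
rewrite !scale_scalar_mx big_cons binS bin1 exprD (mulrCA (c i)).
by rewrite [(-1) ^+ size s * _]mulrCA -mulrA.
Qed.

Lemma word_twist a b X (e : 'I_r -> bool) s :
  (forall i, a i *m X = (-1) ^+ e i *: (X *m b i)) ->
  word a s *m X = (-1) ^+ count e s *: (X *m word b s).
Proof.
move=> H; elim: s => [|i s IH] /=; first by rewrite mulmx1 mul1mx scale1r.
rewrite -mulmxA IH -scalemxAr (mulmxA (a i)) H -scalemxAl scalerA -mulmxA addnC.
by rewrite exprD.
Qed.

(** A generator anticommutes with the [r - 1] other letters, an even number for odd [r]. *)
Lemma word_enum_central a c i : clifford a c -> odd r ->
  a i *m word a (enum 'I_r) = word a (enum 'I_r) *m a i.
Proof.
move=> ca ro; rewrite (clifford_word_comm _ i ca) count_neq_uniq ?enum_uniq //.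
rewrite mem_enum size_enum_ord -signr_odd oddB ?ro ?scale1r //.
by case: r i ro.
Qed.

(** Indices are treated one at a time: [S] plus its image under the j-th involution has sign plus,
    and if this sum vanishes then [S] already has sign minus. The relations with [P], [Q] and the
    volume words survive because these commute with the generators. *)
Lemma twisted_intertwiner a b c (P Q X : 'M[R]_n) :
  clifford a c -> clifford b c ->
  (forall i, P *m a i = a i *m P) -> (forall i, Q *m b i = b i *m Q) ->
  X != 0 -> P *m X = X -> X *m Q = X ->
  (odd r -> word a (enum 'I_r) *m X = X *m word b (enum 'I_r)) ->
  exists S (e : 'I_r -> bool), [/\ S != 0, P *m S = S, S *m Q = S,
     (odd r -> word a (enum 'I_r) *m S = S *m word b (enum 'I_r)) &
     forall i, a i *m S = (-1) ^+ e i *: (S *m b i)].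
Proof.
move=> ca cb Pa Qb; have [cc aa ac] := ca; have [_ bb bc] := cb.
move=> X0 PX XQ wX.
suff [S [S0 PS SQ wS HS]] : exists S : 'M[R]_n, [/\ S != 0, P *m S = S,
    S *m Q = S, (odd r -> word a (enum 'I_r) *m S = S *m word b (enum 'I_r)) &
    forall i, i \in enum 'I_r ->
      exists e : bool, a i *m S = (-1) ^+ e *: (S *m b i)].
  have /fin_all_exists[e He] :
      forall i, exists e : bool, a i *m S = (-1) ^+ e *: (S *m b i).
    by move=> i; apply: HS; rewrite mem_enum.
  by exists S, e.
(* Only the index list of the last clause is generalised; the volume words keep all generators. *)
elim: {3}(enum 'I_r) => [|j l [S [S0 PS SQ wS HS]]].
  by exists X; split=> [||||i] //.
pose S' : 'M[R]_n := S + c j *: (a j *m S *m b j).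
have [S'0|S'0] := eqVneq S' 0.
  exists S; split=> // i; rewrite in_cons => /orP[/eqP->|]; last exact: HS.
  exists true; rewrite expr1 scaleN1r.
  have /eqP := S'0; rewrite addr_eq0 => /eqP {2}->.
  by rewrite mulNmx opprK -scalemxAl -(mulmxA _ (b j)) bb mul_mx_scalar scalerA cc scale1r.
exists S'; split=> //.
- by rewrite mulmxDr PS -scalemxAr !mulmxA Pa -(mulmxA (a j)) PS.
- by rewrite mulmxDl SQ -scalemxAl -!mulmxA -Qb !mulmxA -(mulmxA (a j)) SQ.
- move=> ro; rewrite mulmxDr mulmxDl wS // -scalemxAr -scalemxAl !mulmxA.
  rewrite -(word_enum_central _ ca ro) -(mulmxA (a j) _ S) wS //.
  by rewrite -!mulmxA (word_enum_central _ cb ro).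
move=> i; rewrite in_cons; case: (eqVneq i j) => [-> _|ij /= /HS [e He]].
  exists false; rewrite expr0 scale1r mulmxDr mulmxDl.
  rewrite -scalemxAr -scalemxAl !mulmxA aa mul_scalar_mx -(mulmxA _ (b j)) bb.
  by rewrite mul_mx_scalar !scalerA cc scale1r -scalemxAl scalerA cc scale1r addrC.
(* Exchanging the generators i and j costs one sign on each side, so the earlier sign [e] is
   kept. *)
exists e; rewrite mulmxDr mulmxDl scalerDr He -scalemxAr -scalemxAl; congr (_ + _).
rewrite 2!mulmxA ac // 2!mulNmx -(mulmxA (a j) _ S) He -scalemxAr -scalemxAl.
rewrite -!mulmxA (bc i j ij) !mulmxN !scalerN opprK !scalerA.
by congr (_ *: _); rewrite mulrC.
Qed.

Lemma clifford_intertwiner a b c (P Q X : 'M[R]_n) :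
  clifford a c -> clifford b c ->
  (forall i, P *m a i = a i *m P) -> (forall i, Q *m b i = b i *m Q) ->
  X != 0 -> P *m X = X -> X *m Q = X ->
  (odd r -> word a (enum 'I_r) *m X = X *m word b (enum 'I_r)) ->
  exists S, [/\ S != 0, P *m S = S, S *m Q = S &
     forall i, a i *m S = S *m b i].
Proof.
move=> ca cb Pa Qb X0 PX XQ wX.
have [S [e [S0 PS SQ wS HS]]] := twisted_intertwiner ca cb Pa Qb X0 PX XQ wX.
pose D := filter e (enum 'I_r).
have sD : size D = count e (enum 'I_r) by rewrite size_filter.
(* For odd [r], an odd number of minus signs would make the volume words anticommute with [S], and
   [S] would vanish. *)
have er : odd r -> ~~ odd (size D).
  move=> ro; apply/negP => De.
  have := wS ro; rewrite (word_twist _ HS) -signr_odd -sD De scaleN1r => /eqP.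
  rewrite eq_sym -addr_eq0 -mulr2n -scaler_nat scaler_eq0 pnatr_eq0 /=.
  move=> /eqP Sw; case/eqP: S0.
  by rewrite -(mulmxK (word_unit (enum 'I_r) cb) S) Sw mul0mx.
(* [D'] is [D] if [D] has even size and its complement otherwise. In the second case [r] is even and
   [D'] has odd size too, so in both cases the letters of [D'] other than [i] have the parity of
   [e i]. *)
pose D' := filter (fun i => e i (+) odd (size D)) (enum 'I_r).
have D'P i : odd (count (fun j => j != i) D') = e i.
  have -> := @count_neq_uniq D' i (filter_uniq _ (enum_uniq 'I_r)).
  have -> : (i \in D') = e i (+) odd (size D) by rewrite mem_filter mem_enum andbT.
  have D's : odd (size D') = odd (size D).
    rewrite /D'; case oD: (odd (size D)); last first.
      by rewrite (eq_filter (fun _ => addbF _)).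
    rewrite (eq_filter (fun _ => addbT _)) size_filter.
    have := count_predC e (enum 'I_r); rewrite -sD size_enum_ord => Er.
    have re : odd r = false by apply/negP => /er; rewrite oD.
    by have := congr1 odd Er; rewrite oddD oD re; case: (odd _).
  have iD : (e i (+) odd (size D) <= size D')%N.
    case: (boolP (e i (+) _)) => // ie; rewrite -has_predT.
    by apply/hasP; exists i; rewrite // mem_filter mem_enum ie.
  by rewrite oddB // D's oddb; case: (e i); case: (odd _).
exists (word a D' *m S); split.
- apply: contraNneq S0 => E.
  by rewrite -(mulKmx (word_unit D' ca) S) E mulmx0.
- by rewrite mulmxA (word_commute _ Pa) -mulmxA PS.
- by rewrite -mulmxA SQ.
move=> i; rewrite mulmxA (clifford_word_comm _ _ ca) -signr_odd D'P.
by rewrite -scalemxAl -!mulmxA HS -scalemxAr scalerA -signr_addb addbb scale1r.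
Qed.

End Words.

(** * Adjoints and orthogonal projectors for the inner product *)

Section Adjoint.
Context {R : realType} {n : nat} (G : 'M[R]_n).
Hypotheses (Gsym : G^T = G) (Gpos : forall u : 'rV[R]_n, u != 0 -> 0 < vip G u u).
Implicit Types A E F T U W : 'M[R]_n.

(** A kernel vector of the Gram matrix gives a combination of the rows of [B] of norm zero. *)
Lemma form_rank k (B : 'M[R]_(k, n)) : row_free B -> B *m G *m B^T \in unitmx.
Proof.
move=> fB; rewrite -row_free_unit -kermx_eq0; apply/rowV0P => v.
move=> /sub_kermxP v0; apply/eqP; rewrite -(mulmx_free_eq0 _ fB).
apply/negPn/negP => /Gpos.
have: v *m (B *m G *m B^T) *m v^T = 0 by rewrite v0 mul0mx.
by rewrite /vip trmx_mul !mulmxA => ->; rewrite mxE ltxx.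
Qed.

Lemma form_unit : G \in unitmx.
Proof.
have := @form_rank n 1%:M; rewrite row_free_unit => /(_ (unitmx1 _ _)).
by rewrite mul1mx trmx1 mulmx1.
Qed.

(** Adjoint with respect to [vip] for matrices acting on row vectors from the right. *)
Definition adj A : 'M[R]_n := locked (G *m A^T *m invmx G).

Lemma adjE A : adj A = G *m A^T *m invmx G.
Proof. by rewrite /adj -lock. Qed.

Lemma adjM A B : adj (A *m B) = adj B *m adj A.
Proof. by rewrite !adjE trmx_mul !mulmxA mulmxKV ?form_unit. Qed.

Lemma adjK A : adj (adj A) = A.
Proof.
by rewrite !adjE !trmx_mul trmxK trmx_inv Gsym !mulmxA mulmxV ?form_unit //
  mul1mx mulmxK ?form_unit.
Qed.

Lemma adj_one : adj 1%:M = 1%:M.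
Proof. by rewrite !adjE trmx1 mulmx1 mulmxV ?form_unit. Qed.

Lemma adjD A B : adj (A + B) = adj A + adj B.
Proof. by rewrite !adjE linearD mulmxDr mulmxDl. Qed.

Lemma adjN A : adj (- A) = - adj A.
Proof. by rewrite !adjE linearN mulmxN mulNmx. Qed.

Lemma adjZ x A : adj (x *: A) = x *: adj A.
Proof. by rewrite !adjE linearZ -scalemxAr -scalemxAl. Qed.

Lemma rank_adj A : \rank (adj A) = \rank A.
Proof.
rewrite !adjE mxrankMfree ?row_free_unit ?unitmx_inv ?form_unit //.
by rewrite -mxrank_tr trmx_mul trmxK mxrankMfree // row_free_unit Gsym form_unit.
Qed.

Definition projector E := E *m E = E /\ adj E = E.

Lemma orth_projector W : exists2 U, projector U & (U :=: W)%MS.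
Proof.
have [B fB BW] : exists2 B : 'M_(\rank W, n), row_free B & (B :=: W)%MS.
  by exists (row_base W); [apply: row_base_free | apply: eq_row_base].
have uB := form_rank fB.
(* Orthogonal projection onto the row space of [B], through its inverse Gram matrix. *)
exists (G *m B^T *m invmx (B *m G *m B^T) *m B).
  split.
    rewrite !mulmxA -(mulmxA _ B G) -(mulmxA _ (B *m G)).
    by rewrite mulmxKV.
  rewrite !adjE !trmx_mul trmx_inv !trmx_mul trmxK Gsym !mulmxA.
  by rewrite mulmxK ?form_unit.
apply: eqmx_trans BW; apply/eqmxP; rewrite submxMl /=.
by apply/submxP; exists B; rewrite !mulmxA mulmxV // mul1mx.
Qed.

Lemma projectorC E : projector E -> projector (1%:M - E).
Proof.
case=> EE aE; split; last by rewrite adjD adjN adj_one aE.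
by rewrite mulmxBl mul1mx mulmxBr mulmx1 EE subrr subr0.
Qed.

(** Invariance under [A] gives U A U = U A, and the adjoint of invariance under [adj A] gives U A U
    = A U. *)
Lemma projector_comm U A : projector U ->
  (U *m A <= U)%MS -> (U *m adj A <= U)%MS -> U *m A = A *m U.
Proof.
case=> UU aU /submxP[D UA] /submxP[D' UA'].
have E1 : U *m A *m U = U *m A by rewrite UA -mulmxA UU.
have E2 : U *m adj A *m U = U *m adj A by rewrite UA' -mulmxA UU.
by rewrite -E1; move/(congr1 adj): E2; rewrite !adjM adjK aU mulmxA.
Qed.

Lemma projector_sub U E : projector U -> projector E -> (U <= E)%MS ->
  U *m E = U /\ E *m U = U.
Proof.
move=> [UU aU] [EE aE] /submxP[D UD].
have UE : U *m E = U by rewrite {1}UD -mulmxA EE.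
by split=> //; rewrite -[RHS]aU -[in RHS]UE adjM aU aE.
Qed.

Lemma projectorB U E : projector U -> projector E -> (U <= E)%MS ->
  projector (E - U).
Proof.
move=> pU pE UleE; have [UE EU] := projector_sub pU pE UleE.
have [UU aU] := pU; have [EE aE] := pE; split; last by rewrite adjD adjN aU aE.
by rewrite mulmxBl !mulmxBr EE EU UE UU subrr subr0.
Qed.

(** * Intertwiners of maximal rank between two submodules *)

Section Isomorphism.
Context {r : nat}.
Variables (a b : 'I_r -> 'M[R]_n) (c : 'I_r -> R) (E F : 'M[R]_n).
Hypotheses (ca : clifford a c) (cb : clifford b c).
Hypotheses (aa : forall i, adj (a i) = c i *: a i).
Hypotheses (ab : forall i, adj (b i) = c i *: b i).
Hypotheses (pE : projector E) (pF : projector F).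
Hypotheses (Ea : forall i, E *m a i = a i *m E).
Hypotheses (Fb : forall i, F *m b i = b i *m F).

Definition intertwiner T :=
  [/\ E *m T = T, T *m F = T & forall i, a i *m T = T *m b i].

(** A seed is a nonzero map between given nonzero submodules that already respects the volume words,
    which is what the correction of signs requires when [r] is odd. *)
Definition seeded := forall P Q, P *m P = P -> Q *m Q = Q -> P != 0 -> Q != 0 ->
  E *m P = P -> P *m E = P -> F *m Q = Q -> Q *m F = Q ->
  (forall i, P *m a i = a i *m P) -> (forall i, Q *m b i = b i *m Q) ->
  exists X, [/\ X != 0, P *m X = X, X *m Q = X &
     (odd r -> word a (enum 'I_r) *m X = X *m word b (enum 'I_r))].

(** The row space of [adj T] is the orthogonal complement of the kernel of [T]. It and the image of
    [T] are submodules, so a seed between the remaining parts of [E] and [F] yields an intertwiner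
    [S] to be added to [T]. *)
Lemma intertwiner_grow T : seeded -> intertwiner T ->
  (\rank T < \rank E)%N -> (\rank T < \rank F)%N ->
  exists2 T', intertwiner T' & (\rank T < \rank T')%N.
Proof.
move=> seed [ET TF aT] ltE ltF.
have [U pU UT] := orth_projector (adj T).
have [V pV VT] := orth_projector T.
have VF : (V <= F)%MS by rewrite VT -TF submxMl.
have UE : (U <= E)%MS.
  by rewrite UT -ET adjM; have [_ ->] := pE; rewrite submxMl.
have TV : T *m V = T.
  have /submxP[D ->] : (T <= V)%MS by rewrite VT.
  by have [VV _] := pV; rewrite -mulmxA VV.
have UTT : U *m T = T.
  have /submxP[D /(congr1 adj)] : (adj T <= U)%MS by rewrite UT.
  by have [UU aU] := pU; rewrite adjK adjM aU => ->; rewrite mulmxA UU.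
have aT' i : adj T *m a i = b i *m adj T.
  have /(congr1 adj) := aT i; rewrite !adjM aa ab -scalemxAr -scalemxAl.
  move/(congr1 (GRing.scale (c i))); rewrite !scalerA.
  by have [-> _ _] := ca; rewrite !scale1r.
have Vb i : V *m b i = b i *m V.
  have s : (V *m b i <= V)%MS.
    by rewrite (eqmxMr _ VT) -aT VT submxMl.
  by apply: projector_comm; rewrite ?ab // -scalemxAr scalemx_sub.
have Ua i : U *m a i = a i *m U.
  have s : (U *m a i <= U)%MS.
    by rewrite (eqmxMr _ UT) aT' UT submxMl.
  by apply: projector_comm; rewrite ?aa // -scalemxAr scalemx_sub.
have [UE1 UE2] := projector_sub pU pE UE.
have [VF1 VF2] := projector_sub pV pF VF.
have [PP _] := projectorB pU pE UE; have [QQ _] := projectorB pV pF VF.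
have [EE _] := pE; have [FF _] := pF.
have P0 : E - U != 0.
  by apply: contraTneq ltE => /subr0_eq ->; rewrite UT rank_adj // ltnn.
have Q0 : F - V != 0.
  by apply: contraTneq ltF => /subr0_eq ->; rewrite VT ltnn.
have Pa i : (E - U) *m a i = a i *m (E - U) by rewrite mulmxBl mulmxBr Ea Ua.
have Qb i : (F - V) *m b i = b i *m (F - V) by rewrite mulmxBl mulmxBr Fb Vb.
have [||||X [X0 PX XQ wX]] := seed (E - U) (F - V) PP QQ P0 Q0 _ _ _ _ Pa Qb.
- by rewrite mulmxBr EE UE2.
- by rewrite mulmxBl EE UE1.
- by rewrite mulmxBr FF VF2.
- by rewrite mulmxBl FF VF1.
have [S [S0 PS SQ aS]] := clifford_intertwiner ca cb Pa Qb X0 PX XQ wX.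
have ES : E *m S = S by rewrite -PS mulmxA mulmxBr EE UE2.
have SF : S *m F = S by rewrite -SQ -mulmxA mulmxBl FF VF1.
exists (T + S).
  by split=> [||i]; rewrite ?mulmxDl ?mulmxDr ?ET ?ES ?TF ?SF ?aT ?aS.
have US : U *m S = 0.
  by rewrite -PS mulmxA mulmxBr UE1; have [-> _] := pU; rewrite subrr mul0mx.
have TQ : T *m (F - V) = 0 by rewrite mulmxBr TF TV subrr.
(* [U] fixes [T] and kills [S]. *)
have TTS : (T <= (T + S)%R)%MS.
  by apply/submxP; exists U; rewrite mulmxDr UTT US addr0.
(* If the row spaces agreed, multiplying by [F - V], which fixes [S] and kills [T], would give
   [S = 0]. *)
apply: rank_ltmx; rewrite ltmxE TTS; apply: contra S0 => /submxP[D TSD].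
rewrite -SQ -[S in S *m _](addKr T) TSD mulmxDl -mulmxA TQ mulmx0 mulNmx TQ oppr0.
by rewrite addr0.
Qed.

Lemma intertwiner_exists : seeded -> \rank E = \rank F ->
  exists2 T, intertwiner T & \rank T = \rank E.
Proof.
move=> seed EF.
suff H k : (k <= \rank E)%N -> exists2 T, intertwiner T & (k <= \rank T)%N.
  have [T iT leT] := H _ (leqnn _); exists T => //; apply/eqP.
  rewrite eqn_leq leT andbT; have [<- _ _] := iT; exact: mxrankM_maxl.
elim: k => [_|k IH lk].
  by exists 0 => //; split=> [||i]; rewrite ?mulmx0 ?mul0mx.
have [T iT leT] := IH (ltnW lk).
have [|ltT] := ltnP k (\rank T); first by exists T.
have ltE : (\rank T < \rank E)%N by exact: leq_ltn_trans lk.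
have [|T' iT' ltT'] := @intertwiner_grow T seed iT ltE; first by rewrite -EF.
by exists T' => //; apply: leq_ltn_trans ltT'.
Qed.

End Isomorphism.
End Adjoint.

(** * Lagrangians as projectors, and automorphisms as matrix identities *)

Section HeisenbergType.
Context {R : realType} {m n : nat} {J : 'I_m -> 'M[R]_n} {G : 'M[R]_n}.
Hypothesis HT : is_HType J G.

Let Gsym : G^T = G. Proof. by case: HT. Qed.
Let Gpos : forall u : 'rV[R]_n, u != 0 -> 0 < vip G u u.
Proof. by case: HT. Qed.
Let uG : G \in unitmx. Proof. exact: form_unit. Qed.

Lemma rank_idempotentD (A B : 'M[R]_n) : A *m A = A -> B *m B = B ->
  A *m B = 0 -> B *m A = 0 -> \rank (A + B)%R = (\rank A + \rank B)%N.
Proof.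
move=> AA BB AB BA; rewrite -mxrank_disjoint_sum.
  apply/eqmx_rank; rewrite addmx_sub_adds ?submx_refl //= addsmx_sub.
  by apply/andP; split; apply/submxP; [exists A | exists B];
    rewrite mulmxDr ?AA ?BB ?AB ?BA ?addr0 ?add0r.
apply/eqP/rowV0P => v; rewrite sub_capmx => /andP[/submxP[D vD] /submxP[D' vD']].
by rewrite vD' -BB mulmxA -vD' vD -mulmxA AB mulmx0.
Qed.

Lemma rank_idempotentC (A : 'M[R]_n) : A *m A = A ->
  (\rank A + \rank (1%:M - A)%R)%N = n.
Proof.
move=> AA; rewrite -rank_idempotentD ?(addrC A) ?subrK ?mxrank1 //;
  by rewrite ?mulmxBl ?mulmxBr ?mul1mx ?mulmx1 ?AA ?subrr ?subr0.
Qed.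

Lemma mx_form_ext (A B : 'M[R]_n) :
  (forall u w : 'rV[R]_n, (u *m A *m w^T) 0 0 = (u *m B *m w^T) 0 0) -> A = B.
Proof.
move=> H; apply/matrixP => i j; have := H (delta_mx 0 i) (delta_mx 0 j).
by rewrite trmx_delta -!rowE -!colE !mxE.
Qed.

Lemma Jz_delta i : Jz J (delta_mx 0 i) = J i.
Proof.
rewrite /Jz (bigD1 i) //= mxE !eqxx scale1r big1 ?addr0 // => j ji.
by rewrite mxE (negPf ji) andbF scale0r.
Qed.

(** Anticommutation is the polarisation of the Clifford relation at e_i + e_j. *)
Lemma J_clifford : clifford J (fun=> -1).
Proof.
have [_ _ _ sq _] := HT.
have JJ i : J i *m J i = - 1%:M.
  have := sq (delta_mx 0 i); rewrite Jz_delta /Defs.zip trmx_delta mul_delta_mx mxE.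
  by rewrite !eqxx scaleN1r.
split=> [i|i|i j ij]; first by rewrite mulrNN mulr1.
  by rewrite JJ raddfN.
have JzD : Jz J (delta_mx 0 i + delta_mx 0 j) = J i + J j.
  rewrite -[in RHS]Jz_delta -[in RHS](Jz_delta j) /Jz -big_split /=.
  by apply: eq_bigr => k _; rewrite mxE scalerDl.
have z2 : Defs.zip (delta_mx 0 i + delta_mx 0 j) (delta_mx 0 i + delta_mx 0 j)
    = 1 + 1 :> R.
  rewrite /Defs.zip [_^T]linearD /= !trmx_delta mulmxDl !mulmxDr.
  rewrite !mul_delta_mx_cond !eqxx (negPf ij) [j == i]eq_sym (negPf ij).
  by rewrite !mulr0n !mulr1n addr0 add0r !mxE !eqxx.
have := sq (delta_mx 0 i + delta_mx 0 j).
rewrite JzD z2 mulmxDl !mulmxDr !JJ opprD scalerDl !scaleN1r.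
rewrite [X in _ + X]addrC addrACA -[RHS]addr0 => /addrI /eqP.
by rewrite addr_eq0 => /eqP.
Qed.

Lemma J_unit i : J i \in unitmx.
Proof. by have := word_unit [:: i] J_clifford; rewrite /= mulmx1. Qed.

Lemma adjJ i : adj G (J i) = -1 *: J i.
Proof.
have [_ _ _ _ sk] := HT.
have E : J i *m G = - (G *m (J i)^T).
  apply: mx_form_ext => u w; have := sk (delta_mx 0 i) u w.
  by rewrite Jz_delta /vip trmx_mul !mulmxA mulmxN mulNmx !mxE mulmxA => ->.
by rewrite scaleN1r adjE -[G *m _]opprK -E mulNmx mulmxK.
Qed.

Lemma bracketE (u w : 'rV[R]_n) i :
  bracket J G u w 0 i = (u *m (J i *m G) *m w^T) 0 0.
Proof. by rewrite mxE /vip !mulmxA. Qed.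

Lemma auto_oP xi : isAuto_o J G xi <->
  xi \in unitmx /\ forall i, xi *m J i *m adj G xi = J i.
Proof.
have E u w i : bracket J G (u *m xi) (w *m xi) 0 i =
    (u *m (xi *m J i *m adj G xi *m G) *m w^T) 0 0.
  by rewrite bracketE trmx_mul adjE !mulmxA mulmxKV.
split=> -[uxi H]; split=> //.
  move=> i; apply: (can_inj (mulmxK uG)); apply: mx_form_ext => u w.
  by rewrite -E H bracketE.
by move=> u w; apply/rowP => i; rewrite E H bracketE.
Qed.

(** The second condition says that every [J i] exchanges the subspace with its orthogonal
    complement. *)
Definition lagrangian_projector N :=
  projector G N /\ forall i, J i *m N = (1%:M - N) *m J i.

(** Isotropy says that [J i] maps L into its orthogonal complement. By half dimension the map is
    onto, and since [J i] squares to -1 it maps the complement back into L. *)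
Lemma lag_projector L : isLag J G L ->
  exists2 N, lagrangian_projector N & (N :=: L)%MS.
Proof.
case=> LL rL; have [N pN NL] := orth_projector Gsym Gpos L.
have [NN aN] := pN; exists N => //; split=> // i.
have NJN : N *m J i *m N = 0.
  have [D ND] : exists D, N = D *m L by apply/submxP; rewrite NL.
  have LJL : L *m J i *m G *m L^T = 0.
    apply: mx_form_ext => u w.
    have /rowP/(_ i) := LL _ _ (submxMl u L) (submxMl w L).
    by rewrite bracketE trmx_mul !mulmxA mulmx0 mul0mx => ->; rewrite !mxE.
  rewrite -[X in _ *m X]aN adjE ND trmx_mul !mulmxA -3!(mulmxA D) LJL.
  by rewrite mulmx0 !mul0mx.
have uJ := J_unit i.
have rN : \rank (N *m J i) = \rank (1%:M - N).
  apply: (@addnI (\rank N)); rewrite rank_idempotentC //.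
  by rewrite mxrankMfree ?row_free_unit // NL addnn -mul2n.
have NJ1 : N *m J i *m (1%:M - N) = N *m J i by rewrite mulmxBr NJN mulmx1 subr0.
have : (1%:M - N <= N *m J i)%MS.
  have s : (N *m J i <= (1%:M - N)%R)%MS by rewrite -NJ1 submxMl.
  by rewrite -(geq_leqif (mxrank_leqif_sup s)) rN.
case/submxP => D ND.
have ZJZ : (1%:M - N) *m J i *m (1%:M - N) = 0.
  have [_ JJ _] := J_clifford.
  rewrite {1}ND -(mulmxA D) -(mulmxA N) JJ mul_mx_scalar -scalemxAr -scalemxAl.
  by rewrite -mulmxA mulmxBr NN mulmx1 subrr mulmx0 scaler0.
have -> : J i *m N = (1%:M - N) *m J i *m N.
  by rewrite !mulmxBl mul1mx NJN subr0.
by rewrite -[RHS]mulmx1 -{3}(subrK N 1%:M) mulmxDr ZJZ add0r.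
Qed.

Lemma lagrangian_rank N : lagrangian_projector N -> (2 * \rank N = n)%N.
Proof.
case=> -[NN _] JN; have [m0 _ _ _ _] := HT; pose i := Ordinal m0.
have uJ := J_unit i.
rewrite mul2n -addnn -[RHS](rank_idempotentC NN); congr addn.
rewrite -[RHS](@mxrankMfree _ _ _ _ _ (J i)) ?row_free_unit // -JN.
by rewrite eqmxMfull // row_full_unit.
Qed.

Lemma lagrangian_projector_isLag N : lagrangian_projector N -> isLag J G N.
Proof.
move=> lN; split; last exact: lagrangian_rank.
have [[NN aN] JN] := lN => u w /submxP[D ->] /submxP[D' ->].
apply/rowP => i; rewrite bracketE trmx_mul [RHS]mxE.
have -> : D *m N *m (J i *m G) *m (N^T *m D'^T) =
    D *m (N *m J i *m adj G N) *m G *m D'^T.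
  by rewrite adjE !mulmxA mulmxKV.
by rewrite aN -(mulmxA N) JN mulmxA mulmxBr NN mulmx1 subrr !(mulmx0, mul0mx) mxE.
Qed.

Lemma same_orbit_lagrangian N1 N2 T :
  lagrangian_projector N1 -> lagrangian_projector N2 -> T \in unitmx ->
  (forall i, J i *m T = T *m J i) -> N1 *m T = T *m N2 ->
  same_orbit J G N1 N2.
Proof.
move=> [[NN1 aN1] JN1] [[NN2 aN2] JN2] uT JT NT.
pose Ti := invmx T; pose S := adj G Ti.
have TTi : T *m Ti = 1%:M by rewrite mulmxV.
have aS : adj G S = Ti by rewrite adjK.
have STa : S *m adj G T = 1%:M by rewrite -adjM // TTi adj_one.
have JTi i : J i *m Ti = Ti *m J i.
  by rewrite -[LHS](mulKmx uT) -/Ti (mulmxA T) -JT -(mulmxA _ T) TTi mulmx1.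
have NTi : N2 *m Ti = Ti *m N1.
  by rewrite -[LHS](mulKmx uT) -/Ti (mulmxA T) -NT -(mulmxA _ T) TTi mulmx1.
have NTa : N2 *m adj G T = adj G T *m N1.
  by have := congr1 (adj G) NT; rewrite !adjM // aN1 aN2.
have NS : N1 *m S = S *m N2.
  by have := congr1 (adj G) NTi; rewrite !adjM // aN1 aN2.
have JS i : J i *m S = S *m J i.
  have := congr1 (adj G) (JTi i); rewrite !adjM // adjJ -scalemxAl -scalemxAr.
  by rewrite !scaleN1r => /oppr_inj.
have JTa i : J i *m adj G T = adj G T *m J i.
  have := congr1 (adj G) (JT i); rewrite !adjM // adjJ -scalemxAl -scalemxAr.
  by rewrite !scaleN1r => /oppr_inj.
pose M1 := 1%:M - N1.
have aM1 : adj G M1 = M1 by rewrite adjD adjN adj_one // aN1.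
have NM : N1 *m M1 = 0 by rewrite mulmxBr NN1 mulmx1 subrr.
have MN : M1 *m N1 = 0 by rewrite mulmxBl NN1 mul1mx subrr.
have NJN i : N1 *m J i *m N1 = 0 by rewrite -mulmxA JN1 mulmxA NM mul0mx.
have MJ i : M1 *m J i *m M1 = 0 by rewrite -JN1 -mulmxA NM mulmx0.
pose xi := N1 *m T + M1 *m S.
have axi : adj G xi = adj G T *m N1 + Ti *m M1.
  by rewrite adjD !adjM // aN1 aM1 aS.
have xiJ i : xi *m J i *m adj G xi = J i.
  (* The diagonal blocks vanish because [N1] and [M1] are both isotropic; in the mixed blocks [T]
     cancels its inverse and [S] cancels [adj G T]. *)
  have e1 : N1 *m T *m J i *m (adj G T *m N1) = 0.
    rewrite -(mulmxA N1) -JT -NTa !mulmxA -(mulmxA _ T N2) -NT !mulmxA.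
    by rewrite NJN !mul0mx.
  have e2 : N1 *m T *m J i *m (Ti *m M1) = N1 *m J i *m M1.
    by rewrite -(mulmxA N1) -JT !mulmxA -(mulmxA _ T) TTi mulmx1.
  have e3 : M1 *m S *m J i *m (adj G T *m N1) = M1 *m J i *m N1.
    by rewrite -(mulmxA M1) -JS !mulmxA -(mulmxA _ S) STa mulmx1.
  have e4 : M1 *m S *m J i *m (Ti *m M1) = 0.
    have TiM : Ti *m M1 = (1%:M - N2) *m Ti.
      by rewrite mulmxBr mulmx1 mulmxBl mul1mx NTi.
    have SM : S *m (1%:M - N2) = M1 *m S.
      by rewrite mulmxBr mulmx1 mulmxBl mul1mx NS.
    by rewrite -(mulmxA M1) -JS TiM !mulmxA -(mulmxA _ S) SM !mulmxA MJ !mul0mx.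
  rewrite axi /xi (mulmxDl _ _ (J i)) mulmxDl 2!(mulmxDr (_ *m J i)) e1 e2 e3 e4.
  rewrite add0r addr0.
  have -> : M1 *m J i *m N1 = M1 *m J i by rewrite -JN1 -mulmxA NN1.
  have -> : N1 *m J i *m M1 = N1 *m J i by rewrite mulmxBr mulmx1 NJN subr0.
  by rewrite -mulmxDl addrC subrK mul1mx.
have [m0 _ _ _ _] := HT.
exists xi; split.
  apply/auto_oP; split=> //.
  (* Invertibility of [xi] is read off [xiJ], whose right side is invertible. *)
  by have := J_unit (Ordinal m0); rewrite -xiJ !unitmx_mul => /andP[/andP[]].
rewrite mulmxDr !mulmxA NN1 NM mul0mx addr0 NT.
by apply/eqmxP; apply: eqmxMfull; rewrite row_full_unit.
Qed.

End HeisenbergType.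

Arguments lagrangian_projector {R m n} J G N.

(** * Existence of seeds in the three cases *)

Section Seeds.
Context {R : realType} {n r : nat}.
Implicit Types (a b : 'I_r -> 'M[R]_n) (c : 'I_r -> R).

(** Supplies the rank one matrix [x *m y], fixed by [P] on the left and by [Q] on the right; [e]
    serves to show that it is nonzero. *)
Lemma idempotent_vectors (P Q : 'M[R]_n) :
  P *m P = P -> Q *m Q = Q -> P != 0 -> Q != 0 ->
  exists (x : 'cV[R]_n) (y : 'rV[R]_n),
    [/\ x != 0, P *m x = x, y *m Q = y & exists e : 'cV[R]_n, y *m e = 1%:M].
Proof.
move=> PP QQ P0 Q0.
have [i Qi] : exists i, row i Q != 0.
  case: (pickP (fun i => row i Q != 0)) => [i Qi|H]; first by exists i.
  case/eqP: Q0; apply/row_matrixP => i; rewrite row0.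
  by have /negbFE/eqP := H i.
have [j Pj] : exists j, col j P != 0.
  case: (pickP (fun j => col j P != 0)) => [j Pj|H]; first by exists j.
  case/eqP: P0; apply/matrixP => k j; have /negbFE/eqP/colP/(_ k) := H j.
  by rewrite !mxE.
exists (col j P), (row i Q); split=> //.
- by rewrite colE mulmxA PP.
- by rewrite -row_mul QQ.
have /rV0Pn[k Qk] := Qi.
exists ((row i Q 0 k)^-1 *: delta_mx k 0); rewrite -scalemxAr -colE.
by apply/matrixP => s t; rewrite !ord1 mxE [X in _ * X]mxE mulVf // mxE eqxx.
Qed.

Lemma seeded_even a b E F : ~~ odd r -> seeded a b E F.
Proof.
move=> /negPf er P Q PP QQ P0 Q0 _ _ _ _ _ _.
have [x [y [x0 Px yQ [e ye]]]] := idempotent_vectors PP QQ P0 Q0.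
exists (x *m y); split; rewrite ?er // ?mulmxA ?Px -?mulmxA ?yQ //.
apply: contraNneq x0 => xy0.
by rewrite -[x]mulmx1 -ye mulmxA xy0 mul0mx.
Qed.

(** Both volume words act as the same scalar [k], so any rank one matrix respects them. *)
Lemma seeded_const a b E F (k : R) :
  word a (enum 'I_r) *m E = k *: E -> F *m word b (enum 'I_r) = k *: F ->
  seeded a b E F.
Proof.
move=> aE Fb P Q PP QQ P0 Q0 EP _ FQ QF _ _.
have [x [y [x0 Px yQ [e ye]]]] := idempotent_vectors PP QQ P0 Q0.
have Ex : E *m x = x by rewrite -Px mulmxA EP.
have yF : y *m F = y by rewrite -yQ -mulmxA QF.
exists (x *m y); split; rewrite ?mulmxA ?Px -?mulmxA ?yQ //.
  apply: contraNneq x0 => xy0.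
  by rewrite -[x]mulmx1 -ye mulmxA xy0 mul0mx.
move=> _; rewrite mulmxA -{1}Ex mulmxA aE -scalemxAl Ex -scalemxAl.
by rewrite -{2}yF -mulmxA Fb -scalemxAr yF scalemxAr.
Qed.

(* Some x y - w_a x y w_b is nonzero: otherwise x would be an eigenvector of
   w_a, which has no real eigenvalue. *)
Lemma seeded_complex a b E F :
  word a (enum 'I_r) *m word a (enum 'I_r) = -1%:M ->
  word b (enum 'I_r) *m word b (enum 'I_r) = -1%:M -> seeded a b E F.
Proof.
move=> wa wb P Q PP QQ P0 Q0 _ _ _ _ Pa Qb.
have [x [y [x0 Px yQ [e ye]]]] := idempotent_vectors PP QQ P0 Q0.
have Pw := word_commute (enum 'I_r) Pa; have Qw := word_commute (enum 'I_r) Qb.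
move: (word a _) (word b _) wa wb Pw Qw => u v uu vv Pu Qv.
exists (x *m y - u *m x *m y *m v); split.
- apply: contraNneq x0 => /eqP; rewrite subr_eq0 => /eqP.
  move/(congr1 (mulmx^~ e)); rewrite -mulmxA ye mulmx1 -!mulmxA.
  rewrite [y *m _]mx11_scalar mul_mx_scalar; set k := _ 0 0; rewrite -scalemxAr => xk.
  have ux : u *m x = - (k *: x).
    by rewrite {1}xk -scalemxAr mulmxA uu mulNmx mul1mx scalerN.
  have : (1 + k * k) *: x = 0.
    by rewrite scalerDl scale1r {1}xk ux scalerN scalerA addNr.
  move/eqP; rewrite scaler_eq0 => /orP[|//].
  by rewrite gt_eqF // ltr_wpDr // -expr2 sqr_ge0.
- by rewrite mulmxBr !mulmxA Px Pu -(mulmxA u P) Px.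
- by rewrite mulmxBl -!mulmxA yQ -Qv (mulmxA y) yQ.
move=> _; rewrite mulmxBr mulmxBl !mulmxA uu -!mulmxA vv !mulmxN mulmx1.
by rewrite !mulNmx mul1mx !opprK addrC !mulmxA.
Qed.

End Seeds.

(** * The correspondence between idempotents and involutions *)

Section Involutions.
Context {R : realType} {n : nat}.
Implicit Types A B P T w : 'M[R]_n.

Definition reflection P : 'M[R]_n := P - (1%:M - P).

(** For an involution [w], the idempotent onto its +1 eigenspace; inverse to [reflection]. *)
Definition halfproj w : 'M[R]_n := 2^-1 *: (1%:M + w).

Lemma two_neq0 : 2 != 0 :> R. Proof. by rewrite pnatr_eq0. Qed.

Lemma halfprojN w : halfproj (- w) = 1%:M - halfproj w.
Proof.
apply: (scalerI two_neq0); rewrite scalerBr /halfproj !scalerA mulfV ?two_neq0 //.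
by rewrite !scale1r scaler_nat mulr2n opprD addrACA subrr add0r.
Qed.

(** Two involutions are allowed so that [w' = - w] covers anticommutation. *)
Lemma halfproj_comm w w' T : w *m T = T *m w' -> halfproj w *m T = T *m halfproj w'.
Proof.
move=> wT; rewrite /halfproj -scalemxAl -scalemxAr; congr (_ *: _).
by rewrite mulmxDl mulmxDr mul1mx mulmx1 wT.
Qed.

Lemma halfproj_eigen w : w *m w = 1%:M -> w *m halfproj w = halfproj w.
Proof.
move=> ww; rewrite /halfproj -scalemxAr; congr (_ *: _).
by rewrite mulmxDr mulmx1 ww addrC.
Qed.

Lemma halfproj_idempotent w : w *m w = 1%:M ->
  halfproj w *m halfproj w = halfproj w.
Proof.
move=> ww; rewrite {1}/halfproj -scalemxAl mulmxDl mul1mx halfproj_eigen //.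
by rewrite -mulr2n -scaler_nat scalerA mulVf ?two_neq0 // scale1r.
Qed.

Lemma halfproj_projector (G : 'M[R]_n) w :
  (forall u : 'rV[R]_n, u != 0 -> 0 < vip G u u) ->
  w *m w = 1%:M -> adj G w = w -> projector G (halfproj w).
Proof.
move=> Gpos ww aw; split; first exact: halfproj_idempotent.
by rewrite /halfproj adjZ adjD (adj_one Gpos) aw.
Qed.

Lemma reflectionK P : halfproj (reflection P) = P.
Proof.
rewrite /halfproj /reflection opprB addrA addrAC addrA addrC.
apply: (scalerI two_neq0); rewrite scalerA mulfV ?two_neq0 // scale1r.
by rewrite (addrAC 1%:M) subrr add0r scaler_nat mulr2n.
Qed.

Lemma halfprojK w : reflection (halfproj w) = w.
Proof.
rewrite /reflection -halfprojN /halfproj -scalerBr opprD opprK addrACA subrr add0r.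
by rewrite -mulr2n -scaler_nat scalerA mulVf ?two_neq0 // scale1r.
Qed.

Lemma reflection_sq P : P *m P = P -> reflection P *m reflection P = 1%:M.
Proof.
move=> PP; have NC : P *m (1%:M - P) = 0 by rewrite mulmxBr PP mulmx1 subrr.
have CN : (1%:M - P) *m P = 0 by rewrite mulmxBl PP mul1mx subrr.
have CC : (1%:M - P) *m (1%:M - P) = 1%:M - P.
  by rewrite mulmxBl NC mul1mx subr0.
have := subrK P 1%:M; rewrite /reflection; move: (1%:M - P) NC CN CC.
move=> C NC CN CC <-; rewrite mulmxBl !mulmxBr PP NC CN CC.
by rewrite subr0 sub0r opprK addrC.
Qed.

Lemma reflection_intertwine P Q T :
  reflection P *m T = T *m reflection Q -> P *m T = T *m Q.
Proof. by move/halfproj_comm; rewrite !reflectionK. Qed.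

Lemma reflection_comm P Q T : P *m T = T *m Q ->
  reflection P *m T = T *m reflection Q.
Proof.
move=> PT; rewrite /reflection mulmxBl [(1%:M - P) *m _]mulmxBl mulmxBr.
by rewrite [T *m (1%:M - _)]mulmxBr PT mul1mx mulmx1.
Qed.

(** For commuting involutions: the product has sign plus exactly where the two signs agree. *)
Lemma halfproj_mul w w' : halfproj (w *m w') =
  halfproj w *m halfproj w' + halfproj (- w) *m halfproj (- w').
Proof.
rewrite /halfproj -!scalemxAl -!scalemxAr !scalerA -scalerDr.
rewrite !mulmxDl !mul1mx !mulmxDr !mulmx1 mulmxN mulNmx opprK.
rewrite addrACA (addrACA 1%:M) (addrACA w) !subrr addr0 add0r addrACA.
by rewrite -mulr2n -scaler_nat scalerA mulfVK ?two_neq0.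
Qed.

End Involutions.

(** * Extended Clifford systems, and transitivity when 4 does not divide m *)

Section Transitivity.
Context {R : realType} {m n : nat} {J : 'I_m -> 'M[R]_n} {G : 'M[R]_n}.
Hypothesis HT : is_HType J G.

Let Gsym : G^T = G. Proof. by case: HT. Qed.
Let Gpos : forall u : 'rV[R]_n, u != 0 -> 0 < vip G u u.
Proof. by case: HT. Qed.
Implicit Types N T : 'M[R]_n.

(** Index 0 carries the reflection, so the volume word is the reflection times the volume word of
    the [J i]. *)
Definition extended_system N (i : 'I_m.+1) : 'M[R]_n :=
  if unlift ord0 i is Some j then J j else reflection N.

Definition extended_sign (i : 'I_m.+1) : R :=
  if unlift ord0 i is Some j then -1 else 1.

Lemma extended_word N (s : seq 'I_m) :
  word (extended_system N) [seq lift ord0 i | i <- s] = word J s.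
Proof. by elim: s => //= i s ->; rewrite /extended_system liftK. Qed.

Lemma extended_volume N : word (extended_system N) (enum 'I_m.+1) =
  reflection N *m word J (enum 'I_m).
Proof.
by rewrite enum_ordSl /= extended_word /extended_system unlift_none.
Qed.

Lemma reflection_J N i : lagrangian_projector J G N ->
  reflection N *m J i = - (J i *m reflection N).
Proof.
case=> _ JN.
have JC : J i *m (1%:M - N) = N *m J i.
  by rewrite mulmxBr mulmx1 JN mulmxBl mul1mx subKr.
by rewrite /reflection mulmxBl [J i *m _]mulmxBr JC JN opprB.
Qed.

Lemma extended_clifford N : lagrangian_projector J G N ->
  clifford (extended_system N) extended_sign.
Proof.
move=> lN; have [[NN _] _] := lN; have [cc JJ JC] := J_clifford HT.
rewrite /extended_system /extended_sign; split=> [i|i|i j].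
- by case: unliftP => [k|] _; rewrite ?mulrNN mulr1.
- case: unliftP => [k _|_]; first exact: JJ.
  exact: reflection_sq.
case: unliftP => [k ->|->]; case: unliftP => [l ->|->] ne //.
- by apply: JC; apply: contra ne => /eqP->.
- by rewrite reflection_J ?opprK.
- exact: reflection_J.
Qed.

Lemma extended_adj N i : lagrangian_projector J G N ->
  adj G (extended_system N i) = extended_sign i *: extended_system N i.
Proof.
case=> [[_ aN] _]; rewrite /extended_system /extended_sign.
case: unliftP => [k _|_]; first exact: adjJ.
by rewrite scale1r /reflection !(adjD, adjN) (adj_one Gpos) aN.
Qed.

Lemma same_orbit_extended N1 N2 T :
  lagrangian_projector J G N1 -> lagrangian_projector J G N2 -> T \in unitmx ->
  (forall i, extended_system N1 i *m T = T *m extended_system N2 i) ->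
  same_orbit J G N1 N2.
Proof.
move=> l1 l2 uT H; apply: (same_orbit_lagrangian HT l1 l2 uT).
  by move=> i; have := H (lift ord0 i); rewrite /extended_system liftK.
apply: reflection_intertwine.
by have := H ord0; rewrite /extended_system unlift_none.
Qed.

Lemma same_orbit_seeded N1 N2 :
  lagrangian_projector J G N1 -> lagrangian_projector J G N2 ->
  seeded (extended_system N1) (extended_system N2) 1%:M 1%:M ->
  same_orbit J G N1 N2.
Proof.
move=> l1 l2 seed.
have p1 : projector G (1%:M : 'M[R]_n) by rewrite /projector mulmx1 (adj_one Gpos).
have [||||T [_ _ iT] rT] := intertwiner_exists Gsym Gpos (extended_clifford l1)
  (extended_clifford l2) _ _ p1 p1 _ _ seed erefl.
- by move=> i; apply: extended_adj.
- by move=> i; apply: extended_adj.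
- by move=> i; rewrite mulmx1 mul1mx.
- by move=> i; rewrite mulmx1 mul1mx.
apply: same_orbit_extended l1 l2 _ iT.
by rewrite -row_free_unit /row_free rT mxrank1.
Qed.

Lemma extended_sign_prod : \prod_(i <- enum 'I_m.+1) extended_sign i = (-1) ^+ m.
Proof.
rewrite enum_ordSl big_cons big_map /extended_sign unlift_none mul1r.
under eq_bigr do rewrite liftK.
by rewrite big_const_seq count_predT size_enum_ord iter_mulr_1.
Qed.

Lemma same_orbit_eqmx (L1 L1' L2 L2' : 'M[R]_n) :
  (L1 :=: L1')%MS -> (L2 :=: L2')%MS ->
  same_orbit J G L1 L2 -> same_orbit J G L1' L2'.
Proof.
move=> e1 e2 [xi [axi /eqmxP E]]; exists xi; split=> //; apply/eqmxP.
by apply: eqmx_trans e2; apply: eqmx_trans E; apply/eqmx_sym/eqmxMr.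
Qed.

Lemma lagrangian_transitive L1 L2 : (m %% 4 != 0)%N ->
  isLag J G L1 -> isLag J G L2 -> same_orbit J G L1 L2.
Proof.
move=> m4 /(lag_projector HT)[N1 l1 e1] /(lag_projector HT)[N2 l2 e2].
apply: (same_orbit_eqmx e1 e2); apply: same_orbit_seeded => //.
(* For odd m the extended system has an even number of generators, and seeds carry no volume
   condition. *)
case: (boolP (odd m)) => om; first by apply: seeded_even; rewrite /= om.
suff w2 N : lagrangian_projector J G N ->
    word (extended_system N) (enum 'I_m.+1) *m
    word (extended_system N) (enum 'I_m.+1) = - 1%:M.
  by apply: seeded_complex; apply: w2.
move=> lN; rewrite (word_sq (extended_clifford lN)) ?enum_uniq //.
rewrite extended_sign_prod size_enum_ord -exprD -signr_odd oddD (negPf om) addbF.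
(* With m = 2h the binomial coefficient is (m + 1) h, and h is odd because 4 does not divide m. *)
have -> : odd 'C(m.+1, 2).
  have mE : m = m./2.*2 by rewrite -[LHS]odd_double_half (negPf om).
  rewrite bin2 mE -doubleMr doubleK oddM /= odd_double.
  by rewrite mE -mul2n -[4%N]/(2 * 2)%N -muln_modr modn2 muln_eq0 eqb0 negbK in m4.
by rewrite expr1 raddfN.
Qed.

End Transitivity.

Arguments extended_system {R m n} J N i.

(** * Clifford submodules and their ranks for even m *)

Section CliffordSubmodules.
Context {R : realType} {m n : nat} {J : 'I_m -> 'M[R]_n} {G : 'M[R]_n}.
Hypotheses (HT : is_HType J G) (m_even : ~~ odd m).

Let Gsym : G^T = G. Proof. by case: HT. Qed.
Let Gpos : forall u : 'rV[R]_n, u != 0 -> 0 < vip G u u.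
Proof. by case: HT. Qed.
Implicit Types V W : 'M[R]_n.

Lemma CinvariantP W : Cinvariant J W <-> forall i, (W *m J i <= W)%MS.
Proof.
split=> [H i|H z]; first by rewrite -Jz_delta.
rewrite /Jz mulmx_sumr; apply: summx_sub => i _.
by rewrite -scalemxAr scalemx_sub.
Qed.

Lemma Cinvariant_projector W : Cinvariant J W -> exists2 P,
  projector G P /\ (forall i, P *m J i = J i *m P) & (P :=: W)%MS.
Proof.
move=> /CinvariantP iW; have [P pP PW] := orth_projector Gsym Gpos W.
have iP i : (P *m J i <= P)%MS by rewrite (eqmxMr _ PW) PW.
exists P => //; split=> // i; apply: (projector_comm Gsym Gpos pP (iP i)).
by rewrite (adjJ HT) -scalemxAr scalemx_sub.
Qed.

(** For even m there is a nonzero intertwiner from W to V. Its image is V by irreducibility, and its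
    kernel in W is the remaining submodule. *)
Lemma Cirreducible_split V W : Cirreducible J V -> Cinvariant J W ->
  \rank W != 0%N ->
  exists2 W', Cinvariant J W' & (\rank W = \rank V + \rank W')%N.
Proof.
move=> [iV V0 irrV] iW W0.
have [P [[PP aP] PJ] PW] := Cinvariant_projector iW.
have [Q [[QQ aQ] QJ] QV] := Cinvariant_projector iV.
have P0 : P != 0 by rewrite -mxrank_eq0 PW.
have Q0 : Q != 0 by rewrite -mxrank_eq0 QV.
have [X [X0 PX XQ wX]] := @seeded_even _ _ _ J J 1%:M 1%:M m_even P Q PP QQ P0 Q0
  (mul1mx _) (mulmx1 _) (mul1mx _) (mulmx1 _) PJ QJ.
have cJ := J_clifford HT.
have [S [S0 PS SQ JS]] := clifford_intertwiner cJ cJ PJ QJ X0 PX XQ wX.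
exists (P :&: kermx S)%MS.
  apply/CinvariantP => i; rewrite sub_capmx; apply/andP; split.
    by apply: submx_trans (submxMr _ (capmxSl _ _)) _; rewrite PJ submxMl.
  apply/sub_kermxP; rewrite -mulmxA JS mulmxA.
  by have /sub_kermxP-> : (P :&: kermx S <= kermx S)%MS by [exact: capmxSr];
    rewrite mul0mx.
rewrite -PW -(mxrank_mul_ker P S) PS; congr addn.
have SV : (S <= V)%MS by rewrite -QV -SQ submxMl.
have iS : Cinvariant J S by apply/CinvariantP => i; rewrite -JS submxMl.
have [/eqP|/eqmx_rank //] := irrV S SV iS.
by rewrite mxrank_eq0 (negPf S0).
Qed.

Lemma Cirreducible_dvd V W : Cirreducible J V -> Cinvariant J W ->
  (\rank V %| \rank W)%N.
Proof.
move=> irrV; have [_ V0 _] := irrV.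
have [k] := ubnP (\rank W); elim: k W => // k IH W lk iW.
have [->|W0] := eqVneq (\rank W) 0%N; first exact: dvdn0.
have [W' iW' rW] := Cirreducible_split irrV iW W0.
rewrite rW dvdn_addr // IH // -ltnS (leq_trans _ lk) // rW ltnS.
by rewrite -[X in (X < _)%N]add0n ltn_add2r lt0n.
Qed.

(** For positive p, [d] is the common dimension of the irreducible summands. *)
Lemma isotypic_rank p : isotypic J p -> exists d : nat,
  [/\ (0 < d)%N, n = (p * d)%N,
      forall W, Cinvariant J W -> (d %| \rank W)%N
    & forall k, (k <= p)%N -> exists2 W, Cinvariant J W & \rank W = (k * d)%N].
Proof.
case=> V [irrV dirV sumV].
case: p V irrV dirV sumV => [|p] V irrV dirV sumV.
  (* With p = 0 there is no summand to measure; the space is zero and [d] is set to 1. *)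
  have n0 : n = 0%N.
    by rewrite -(mxrank1 R n) -(eqmx_rank sumV) big_ord0 mxrank0.
  exists 1%N; split=> [||W _|k]; [by [] | exact: n0 | exact: dvd1n | ].
  rewrite leqn0 => /eqP->; exists 0; last by rewrite mxrank0.
  by move=> z; rewrite mul0mx sub0mx.
have rV k : \rank (V k) = \rank (V ord0).
  by apply/eqP; rewrite eqn_dvd !Cirreducible_dvd //; case: (irrV k);
     case: (irrV ord0).
exists (\rank (V ord0)); split.
- by case: (irrV ord0) => _; rewrite lt0n.
- rewrite -[LHS](mxrank1 R n) -(eqmx_rank sumV) (mxdirectP dirV) /=.
  by under eq_bigr do rewrite rV; rewrite sum_nat_const card_ord.
- by move=> W iW; apply: Cirreducible_dvd.
move=> k lk; exists (\sum_(j < p.+1 | (j < k)%N) V j)%MS.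
  apply/CinvariantP => i; rewrite sumsmxMr; apply/sumsmx_subP => j jk.
  have [/CinvariantP/(_ i) iV _ _] := irrV j.
  by apply: submx_trans iV _; apply: sumsmx_sup jk _.
have dk : mxdirect (\sum_(j < p.+1 | (j < k)%N) V j)%MS.
  apply/mxdirect_sumsP => i ik; apply/eqP; rewrite -submx0.
  have /mxdirect_sumsP/(_ i isT) E := dirV; rewrite -[X in (_ <= X)%MS]E.
  apply: capmxS; first exact: submx_refl.
  apply/sumsmx_subP => j /andP[_ ji]; by apply: (sumsmx_sup j).
rewrite (mxdirectP dk) /=; under eq_bigr do rewrite rV.
by rewrite (big_ord_narrow lk) sum_nat_const card_ord.
Qed.

End CliffordSubmodules.

(** * Adjoints of words, and gluing maps along complementary projectors *)

Section AdjointWord.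
Context {R : realType} {n r : nat} (G : 'M[R]_n).
Hypothesis Gpos : forall u : 'rV[R]_n, u != 0 -> 0 < vip G u u.

(** The adjoint reverses the word; restoring the order costs the same sign as squaring the word. *)
Lemma adj_word (a : 'I_r -> 'M[R]_n) c s : clifford a c ->
  (forall i, adj G (a i) = c i *: a i) -> uniq s ->
  adj G (word a s) = ((-1) ^+ 'C(size s, 2) * \prod_(i <- s) c i) *: word a s.
Proof.
move=> ca aa; elim: s => [|i s IH] /=.
  by rewrite big_nil mulr1 scale1r (adj_one Gpos).
case/andP=> si us; have := clifford_word_comm s i ca.
rewrite count_neq_uniq // (negPf si) subn0 => C.
rewrite (adjM Gpos) aa IH // C -scalemxAl -scalemxAr !scalerA; congr (_ *: _).
rewrite big_cons binS bin1 exprD.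
rewrite [RHS]mulrAC -(mulrA _ ((-1) ^+ size s) ((-1) ^+ size s)).
rewrite -(expr2 ((-1) ^+ size s)) sqrr_sign mulr1.
by rewrite -mulrA [X in _ * X]mulrC.
Qed.
End AdjointWord.

(** By the rank conditions the row space of the sum contains those of [Q] and of its complement. *)
Lemma unitmx_projectorD (F : fieldType) n (P Q T1 T2 : 'M[F]_n) :
  P *m P = P -> P *m T1 = T1 -> T1 *m Q = T1 ->
  (1%:M - P) *m T2 = T2 -> T2 *m (1%:M - Q) = T2 ->
  \rank T1 = \rank Q -> \rank T2 = \rank (1%:M - Q) -> T1 + T2 \in unitmx.
Proof.
move=> PP PT1 T1Q PT2 T2Q r1 r2; rewrite -row_full_unit -sub1mx.
have P0 : P *m (1%:M - P) = 0 by rewrite mulmxBr PP mulmx1 subrr.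
have PT : P *m (T1 + T2) = T1 by rewrite mulmxDr PT1 -PT2 mulmxA P0 mul0mx addr0.
have PT' : (1%:M - P) *m (T1 + T2) = T2.
  by rewrite mulmxBl PT mul1mx addrC addKr.
have s1 : (Q <= (T1 + T2)%R)%MS.
  apply: (@submx_trans _ _ _ _ _ _ T1); last by rewrite -{1}PT submxMl.
  have s : (T1 <= Q)%MS by rewrite -T1Q submxMl.
  by rewrite -(geq_leqif (mxrank_leqif_sup s)) r1.
have s2 : ((1%:M - Q)%R <= (T1 + T2)%R)%MS.
  apply: (@submx_trans _ _ _ _ _ _ T2); last by rewrite -{1}PT' submxMl.
  have s : (T2 <= (1%:M - Q)%R)%MS by rewrite -T2Q submxMl.
  by rewrite -(geq_leqif (mxrank_leqif_sup s)) r2.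
by rewrite -[1%:M](subrK Q) addmx_sub.
Qed.

(** * The p + 1 orbits when 4 divides m *)

Section DivisibleByFour.
Context {R : realType} {m n : nat} {J : 'I_m -> 'M[R]_n} {G : 'M[R]_n}.
Hypotheses (HT : is_HType J G) (m4 : (m %% 4 = 0)%N).

Let Gsym : G^T = G. Proof. by case: HT. Qed.
Let Gpos : forall u : 'rV[R]_n, u != 0 -> 0 < vip G u u.
Proof. by case: HT. Qed.
Implicit Types N P T : 'M[R]_n.

Let m_half : m = m./2.*2 /\ ~~ odd m./2.
Proof.
have /eqP m2 : (m %% 2 == 0)%N.
  by have := modn_dvdm m (isT : 2 %| 4)%N; rewrite m4 => <-.
have mE : m = m./2.*2 by rewrite -[LHS]odd_double_half -modn2 m2.
split=> //; move: m4; rewrite {1}mE -mul2n -[4%N]/(2 * 2)%N -muln_modr modn2.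
by move/eqP; rewrite muln_eq0 eqb0.
Qed.

Let m_even : ~~ odd m.
Proof. by case: m_half => -> _; rewrite odd_double. Qed.

Definition volume : 'M[R]_n := word J (enum 'I_m).

(** The sign governing both the square and the adjoint of the volume element; with m = 2h, h even,
    the exponent (m - 1) h + m is even. *)
Lemma volume_scalar : (-1) ^+ 'C(size (enum 'I_m), 2) *
  \prod_(i <- enum 'I_m) (-1) = 1 :> R.
Proof.
rewrite big_const_seq count_predT size_enum_ord iter_mulr_1 -exprD -signr_odd.
have [mE m2] := m_half.
rewrite oddD (negPf m_even) addbF bin2 {1}mE -doubleMl doubleK oddM.
by rewrite (negPf m2).
Qed.

Lemma volume_sq : volume *m volume = 1%:M.
Proof. by rewrite (word_sq (J_clifford HT)) ?enum_uniq // volume_scalar. Qed.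

Lemma volume_adj : adj G volume = volume.
Proof.
rewrite (adj_word Gpos (J_clifford HT)) ?enum_uniq //; last exact: adjJ.
by rewrite volume_scalar scale1r.
Qed.

(** [J i] anticommutes with the other m - 1 letters, an odd number. *)
Lemma volume_J i : J i *m volume = - volume *m J i.
Proof.
rewrite (clifford_word_comm _ _ (J_clifford HT)) count_neq_uniq ?enum_uniq //.
rewrite mem_enum size_enum_ord -signr_odd oddB; last by case: m i => // -[].
by rewrite (negPf m_even) /= expr1 scaleN1r mulNmx.
Qed.

Lemma volume_comm P : (forall i, P *m J i = J i *m P) ->
  P *m volume = volume *m P.
Proof. exact: word_commute. Qed.

(** The reflection anticommutes with each of the m letters, an even number. *)
Lemma volume_reflection N : lagrangian_projector J G N ->
  reflection N *m volume = volume *m reflection N.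
Proof.
move=> lN; have := clifford_word_comm [seq lift ord0 i | i <- enum 'I_m] ord0
  (extended_clifford HT lN).
rewrite extended_word count_map (eq_count (a2 := predT)) // count_predT.
by rewrite size_enum_ord -signr_odd (negPf m_even) scale1r /extended_system unlift_none.
Qed.

(* The two irreducible modules of the algebra generated by the J_i and the
   reflection in N are told apart by the sign of its central volume element. *)
Definition sign_projector N := halfproj (reflection N *m volume).

Lemma extended_volume_sq N : lagrangian_projector J G N ->
  (reflection N *m volume) *m (reflection N *m volume) = 1%:M.
Proof.
move=> lN; have [[NN _] _] := lN.
rewrite {2}volume_reflection // mulmxA -(mulmxA _ volume volume) volume_sq mulmx1.
exact: reflection_sq.
Qed.

Lemma sign_projectorP N : lagrangian_projector J G N ->
  projector G (sign_projector N).
Proof.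
move=> lN; have [[NN aN] _] := lN.
apply: (halfproj_projector Gpos); first exact: extended_volume_sq.
rewrite (adjM Gpos) volume_adj volume_reflection // /reflection.
by rewrite !(adjD, adjN) (adj_one Gpos) aN.
Qed.

Lemma sign_projector_extended N i : lagrangian_projector J G N ->
  sign_projector N *m extended_system J N i =
  extended_system J N i *m sign_projector N.
Proof.
move=> lN; apply: halfproj_comm; rewrite -extended_volume.
by rewrite (word_enum_central _ (extended_clifford HT lN)) //=.
Qed.

Lemma sign_projector_J N i : lagrangian_projector J G N ->
  sign_projector N *m J i = J i *m sign_projector N.
Proof.
by move/(sign_projector_extended (lift ord0 i)); rewrite /extended_system liftK.
Qed.

(** The two eigenspaces of the extended volume element are matched separately, with scalars 1 and
    -1, and the two intertwiners are added. *)
Lemma same_orbit_rank N1 N2 :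
  lagrangian_projector J G N1 -> lagrangian_projector J G N2 ->
  \rank (sign_projector N1) = \rank (sign_projector N2) ->
  same_orbit J G N1 N2.
Proof.
move=> l1 l2 rk.
have p1 := sign_projectorP l1; have p2 := sign_projectorP l2.
have c1 i := sign_projector_extended i l1.
have c2 i := sign_projector_extended i l2.
have q1 := projectorC Gpos p1; have q2 := projectorC Gpos p2.
have ex := intertwiner_exists Gsym Gpos (extended_clifford HT l1)
  (extended_clifford HT l2) (fun i => extended_adj HT i l1)
  (fun i => extended_adj HT i l2).
have C N : (forall i, sign_projector N *m extended_system J N i =
    extended_system J N i *m sign_projector N) ->
  forall i, (1%:M - sign_projector N) *m extended_system J N i =
    extended_system J N i *m (1%:M - sign_projector N).
  by move=> H i; rewrite mulmxBl mulmxBr H mulmx1 mul1mx.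
have w1 := extended_volume_sq l1; have w2 := extended_volume_sq l2.
have e1 := halfproj_eigen w1; have e2 := halfproj_eigen w2.
have f1 : sign_projector N2 *m (reflection N2 *m volume) = sign_projector N2.
  by rewrite -[RHS]e2; apply: halfproj_comm.
have [|T1 [ET1 TF1 iT1] rT1] := ex _ _ p1 p2 c1 c2 _ rk.
  by apply: (seeded_const (k := 1)); rewrite extended_volume scale1r.
have rk' : \rank (1%:M - sign_projector N1) = \rank (1%:M - sign_projector N2).
  by apply: (@addnI (\rank (sign_projector N1))); rewrite {2}rk !rank_idempotentC
    //; [case: p2 | case: p1].
have [|T2 [ET2 TF2 iT2] rT2] := ex _ _ q1 q2 (C _ c1) (C _ c2) _ rk'.
  apply: (seeded_const (k := -1)); rewrite extended_volume scaleN1r.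
    rewrite mulmxBr e1 mulmx1 -{1}[_ *m volume]halfprojK.
    by rewrite /reflection addrAC subrr add0r.
  rewrite mulmxBl f1 mul1mx -{1}[_ *m volume]halfprojK.
  by rewrite /reflection addrAC subrr add0r.
apply: (same_orbit_extended HT l1 l2 (T := T1 + T2)).
  have [[PP _] [QQ _]] := (p1, p2).
  by apply: (unitmx_projectorD PP ET1 TF1 ET2 TF2); rewrite ?rT1 ?rT2 ?rk ?rk'.
by move=> i; rewrite mulmxDr mulmxDl iT1 iT2.
Qed.

(** Passing one letter turns [xi] into its inverse adjoint and conversely, so an even number of
    letters restores it. *)
Lemma auto_volume_comm xi : isAuto_o J G xi -> xi *m volume = volume *m xi.
Proof.
move=> /(auto_oP HT)[uxi xiJ]; have [_ JJ _] := J_clifford HT.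
pose S := invmx (adj G xi).
have uaxi : adj G xi \in unitmx.
  by rewrite -row_free_unit /row_free rank_adj // mxrank_unit.
have xJ i : xi *m J i = J i *m S by rewrite -[in RHS](xiJ i) mulmxK.
have SJ i : S *m J i = J i *m xi.
  have JJ' : J i *m (- J i) = 1%:M by rewrite mulmxN JJ -raddfN opprK.
  have JJ2 : (- J i) *m J i = 1%:M by rewrite mulNmx JJ -raddfN opprK.
  rewrite -[LHS]mul1mx -JJ' -!mulmxA; congr (_ *m _).
  by rewrite !mulmxA mulNmx -[_ *m S]xJ -mulmxN -mulmxA JJ2 mulmx1.
have H s : xi *m word J s = word J s *m (if odd (size s) then S else xi) /\
    S *m word J s = word J s *m (if odd (size s) then xi else S).
  elim: s => [|i s [IH1 IH2]] /=; first by rewrite !mulmx1 !mul1mx.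
  by rewrite !mulmxA xJ SJ -!mulmxA IH1 IH2; case: (odd _).
by have [-> _] := H (enum 'I_m); rewrite size_enum_ord (negPf m_even).
Qed.

(** The sign projector is the sum of N H and (1 - N)(1 - H), with H the volume projector, and [J i]
    exchanges the two. The resulting formula makes orbit invariance visible, since automorphisms
    commute with H. *)
Lemma sign_projector_rank N : lagrangian_projector J G N ->
  \rank (sign_projector N) = (2 * \rank (N *m halfproj volume))%N.
Proof.
move=> lN; have [[NN _] JN] := lN; have [m0 _ _ _ _] := HT.
pose i := Ordinal m0; pose H := halfproj volume.
have HH : H *m H = H by apply: halfproj_idempotent; apply: volume_sq.
have NH : N *m H = H *m N.
  apply/esym/halfproj_comm/esym/reflection_intertwine.
  exact: volume_reflection.
have JH : J i *m H = (1%:M - H) *m J i.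
  by rewrite -halfprojN; apply/esym/halfproj_comm; rewrite mulNmx volume_J mulNmx.
have -> : sign_projector N = N *m H + (1%:M - N) *m (1%:M - H).
  by rewrite /sign_projector halfproj_mul !halfprojN reflectionK.
have uJ := J_unit HT i.
have C : (1%:M - N) *m (1%:M - H) = (1%:M - H) *m (1%:M - N).
  have C1 : N *m (1%:M - H) = (1%:M - H) *m N.
    by rewrite mulmxBr mulmxBl mulmx1 mul1mx NH.
  by rewrite [LHS]mulmxBl [RHS]mulmxBr mul1mx mulmx1 C1.
have N0 : N *m (1%:M - N) = 0 by rewrite mulmxBr NN mulmx1 subrr.
have N1 : (1%:M - N) *m N = 0 by rewrite mulmxBl NN mul1mx subrr.
have H2 : (1%:M - H) *m (1%:M - H) = 1%:M - H.
  by rewrite mulmxBl mul1mx mulmxBr mulmx1 HH subrr subr0.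
have N2 : (1%:M - N) *m (1%:M - N) = 1%:M - N.
  by rewrite mulmxBl mul1mx mulmxBr mulmx1 NN subrr subr0.
rewrite rank_idempotentD.
- rewrite mul2n -addnn; congr addn.
  rewrite -(@mxrankMfree _ _ _ _ _ (J i)) ?row_free_unit //.
  by rewrite -mulmxA -JH mulmxA -JN -mulmxA eqmxMfull ?row_full_unit.
- by rewrite {2}NH mulmxA -(mulmxA N) HH -mulmxA -NH mulmxA NN.
- by rewrite {2}C mulmxA -(mulmxA _ (1%:M - H) (1%:M - H)) H2 -mulmxA -C mulmxA N2.
- by rewrite NH mulmxA -(mulmxA H) N0 mulmx0 mul0mx.
by rewrite C mulmxA -(mulmxA (1%:M - H)) N1 mulmx0 mul0mx.
Qed.

Lemma rank_same_orbit N1 N2 :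
  lagrangian_projector J G N1 -> lagrangian_projector J G N2 ->
  same_orbit J G N1 N2 ->
  \rank (sign_projector N1) = \rank (sign_projector N2).
Proof.
move=> l1 l2 [xi [axi /eqmxP E]]; rewrite !sign_projector_rank //; congr (2 * _)%N.
have [uxi _] := axi.
rewrite -(eqmxMr (halfproj volume) E) -mulmxA.
rewrite -(halfproj_comm (esym (auto_volume_comm axi))) mulmxA.
by rewrite mxrankMfree // row_free_unit.
Qed.

(** The involution [w] inherits anticommutation with every [J i] from the volume, as the reflection
    in [P] commutes with them; the volume squares to 1, which recovers [P]. *)
Lemma lagrangian_with_sign P : projector G P ->
  (forall i, P *m J i = J i *m P) ->
  exists2 N, lagrangian_projector J G N & sign_projector N = P.
Proof.
move=> [PP aP] PJ; pose w := volume *m reflection P.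
have rv : reflection P *m volume = volume *m reflection P.
  by apply: reflection_comm; apply: volume_comm.
have rJ i : reflection P *m J i = J i *m reflection P by apply: reflection_comm.
have ar : adj G (reflection P) = reflection P.
  by rewrite /reflection !(adjD, adjN) (adj_one Gpos) aP.
have ww : w *m w = 1%:M.
  rewrite /w -{1}rv mulmxA -(mulmxA _ volume volume) volume_sq mulmx1.
  exact: reflection_sq.
exists (halfproj w); last first.
  by rewrite /sign_projector halfprojK /w -rv -mulmxA volume_sq mulmx1 reflectionK.
split; first by apply: (halfproj_projector Gpos ww); rewrite (adjM Gpos) volume_adj ar.
move=> i; rewrite -halfprojN; apply/esym/halfproj_comm.
by rewrite /w mulNmx -mulmxA rJ !mulmxA volume_J !mulNmx.
Qed.

Lemma lagrangian_orbits p : isotypic J p ->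
  exists Ls : 'I_p.+1 -> 'M[R]_n,
    [/\ forall k, isLag J G (Ls k),
        forall k l, same_orbit J G (Ls k) (Ls l) -> k = l
      & forall L, isLag J G L -> exists k, same_orbit J G (Ls k) L].
Proof.
move=> /(isotypic_rank HT m_even)[d [d0 nE dvd ex]].
(* The k-th representative has a submodule of rank k d as its positive part. *)
have /fin_all_exists[Ls LsP] (k : 'I_p.+1) : exists N,
    lagrangian_projector J G N /\ \rank (sign_projector N) = (k * d)%N.
  have [W iW rW] := ex k (ltn_ord k).
  have [P [pP PJ] PW] := Cinvariant_projector HT iW.
  by have [N lN NP] := lagrangian_with_sign pP PJ; exists N; rewrite NP PW.
exists Ls; split=> [k|k l|L].
- by apply: lagrangian_projector_isLag => //; have [] := LsP k.
- have [[lk rk] [ll rl]] := (LsP k, LsP l) => /(rank_same_orbit lk ll).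
  by rewrite rk rl => /eqP; rewrite eqn_pmul2r // => /eqP/val_inj.
move=> /(lag_projector HT)[N lN NL].
(* The positive part of any Lagrangian is a submodule, so its rank is k d, and k is at most p
   because n = p d. *)
have iN : Cinvariant J (sign_projector N).
  by apply/CinvariantP => i; rewrite sign_projector_J // submxMl.
have /dvdnP[k rk] := dvd _ iN.
have kp : (k < p.+1)%N.
  by rewrite ltnS -(leq_pmul2r d0) -rk -nE rank_leq_row.
exists (Ordinal kp); have [lk rLk] := LsP (Ordinal kp).
by apply: (same_orbit_eqmx (eqmx_refl _) NL); apply: same_orbit_rank; rewrite ?rLk.
Qed.

End DivisibleByFour.

Unset Implicit Arguments.

Theorem theorem4p6 (R : realType) (m n : nat)
    (J : 'I_m -> 'M[R]_n) (G : 'M[R]_n) :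
  is_HType J G ->
  ((m %% 4 != 0)%N ->
     forall L1 L2 : 'M[R]_n, isLag J G L1 -> isLag J G L2 -> same_orbit J G L1 L2)
  /\
  ((m %% 4 = 0)%N -> forall p : nat, isotypic J p ->
     exists Ls : 'I_p.+1 -> 'M[R]_n,
       [/\ forall k, isLag J G (Ls k),
           forall k l, same_orbit J G (Ls k) (Ls l) -> k = l
         & forall L, isLag J G L -> exists k, same_orbit J G (Ls k) L]).
Proof.
move=> HT; split=> [m4 L1 L2|m4 p]; first exact: lagrangian_transitive.
exact: lagrangian_orbits.
Qed.
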